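(* Let $(S,\Sigma,\mu)$ be a measure space, let $\mathcal{E}=(E_s)_{s\in S}$ be a family of $\mathbb{R}$-Banach spaces, and let $p$ be a real number. Suppose that $\mu$ is $\sigma$-finite, that $\mathcal{E}$ is a discrete measurable family, and that $1<p<\infty$. Then the $L^p$ direct integral $L^p(\mathcal{E})$ is strictly convex if and only if $E_s$ is strictly convex for almost all $s\in S$.
   Context: Strict convexity: a normed $\mathbb{R}$-vector space $E$ is strictly convex if every affine map $\gamma:[-1,1]\to E$ whose image is contained in the unit sphere is constant. Direct integrals. Let $(S,\Sigma,\mu)$ be a measure space and $\mathcal{E}=(E_s)_{s\in S}$ a family of $\mathbb{K}$-Banach spaces ($\mathbb{K}=\mathbb{R}$ or $\mathbb{C}$; here $\mathbb{K}=\mathbb{R}$). Let $\Phi_{\mathcal{E}}=\{E_s : s\in S\}$ be the set of Banach spaces occurring in the family (so $s,t$ determine the same element iff $E_s=E_t$), equipped with the discrete $\sigma$-algebra (all subsets), and let $\Omega_{\mathcal{E}}=\coprod_{E\in\Phi_{\mathcal{E}}}E$, equipped with the disjoint union topology and its Borel $\sigma$-algebra. The family $\mathcal{E}$ is measurable if the map $S\to\Phi_{\mathcal{E}}$, $s\mapsto E_s$, is measurable. A section is an element $\sigma$ of $\Pi_{\mathcal{E}}=\prod_{s\in S}E_s$; it is measurable if, seen as a map $S\to\Omega_{\mathcal{E}}$, it is measurable, and strongly measurable if moreover the set of its non-zero values $\sigma(S)^*\subset\Omega_{\mathcal{E}}$ is separable. For $p\in[1,\infty]$ and a measurable section $\sigma$,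 $\|\sigma\|_p\in[0,\infty]$ is the $p$-norm of the function $s\mapsto\|\sigma(s)\|_{E_s}$, i.e. $\left(\int_S\|\sigma(s)\|_{E_s}^p\,d\mu(s)\right)^{1/p}$ if $p<\infty$ and the essential supremum if $p=\infty$. $\mathcal{L}^p(\mathcal{E})$ is the space of strongly measurable sections with $\|\sigma\|_p<\infty$, $\mathcal{N}(\mathcal{E})$ the space of strongly measurable sections equal to zero almost everywhere, and the $L^p$ direct integral is $L^p(\mathcal{E})=\mathcal{L}^p(\mathcal{E})/\mathcal{N}(\mathcal{E})$ with the norm $\|\cdot\|_p$. Discreteness: for $E\in\Phi_{\mathcal{E}}$ let $S_E=\{s\in S : E_s=E\}$. A measurable family $\mathcal{E}$ is discrete if $\mu(\{s\in S : \mu(S_{E_s})=0\})=0$. *)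

(* Defs.v *)
From HB Require Import structures.
From mathcomp Require Import all_boot all_order all_algebra.
From mathcomp Require Import generic_quotient ring_quotient.
From mathcomp Require Import all_classical all_reals all_analysis.
From mathcomp Require Import measurable_realfun ess_sup_inf.
Set Implicit Arguments.
Unset Strict Implicit.
Unset Printing Implicit Defensive.
Import Order.TTheory GRing.Theory Num.Theory.
Import numFieldNormedType.Exports.
Local Open Scope classical_set_scope.
Local Open Scope ring_scope.
Local Open Scope quotient_scope.

Definition affine_on (R : numDomainType) (V : lmodType R) (i : interval R)
    (f : R -> V) :=
  forall x y t : R, x \in i -> y \in i -> 0 <= t <= 1 ->
    f ((1 - t) * x + t * y) = (1 - t) *: f x + t *: f y.

(* Maps on [-1, 1] are represented by total maps on R, whose values outside
   [-1, 1] play no role. *)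
Definition strictly_convex (R : realType) (V : normedModType R) :=
  forall gamma : R -> V, affine_on `[-1, 1] gamma ->
    (forall x, x \in `[-1, 1] -> `|gamma x| = 1) ->
    forall x y, x \in `[-1, 1] -> y \in `[-1, 1] -> gamma x = gamma y.

Definition separable_set (T : topologicalType) (A : set T) :=
  exists C : set T, [/\ C `<=` A, countable C & A `<=` closure C].

Definition cast_space (R : realType) (F G : completeNormedModType R)
    (e : F = G) (x : F) : G :=
  eq_rect F (fun H : completeNormedModType R => H) x G e.

Section family.
Context (R : realType) d (S : measurableType d).
Variable E : S -> completeNormedModType R.

(* The set {E_s | s in S} of the Banach spaces occurring in the family lives in
   a larger universe than S and the E_s, so that it cannot carry a topology or
   a sigma-algebra of the library. It is represented by its copy [spaces], the
   quotient of S by the equality E_s = E_t (see [space_ofP]); [space phi] is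
   the Banach space named by [phi], and [space (space_of s)] is equal to E_s,
   though only propositionally (see [spaceE]), whence [cast_space]. *)
Definition same_space (s t : S) : bool := `[< E s = E t >].

Lemma same_space_refl : reflexive same_space.
Proof. by move=> s; exact/asboolP. Qed.

Lemma same_space_sym : symmetric same_space.
Proof. by move=> s t; apply/asboolP/asboolP => ->. Qed.

Lemma same_space_trans : transitive same_space.
Proof. by move=> t s u /asboolP st /asboolP tu; apply/asboolP; rewrite st. Qed.

Canonical same_space_equiv :=
  EquivRel same_space same_space_refl same_space_sym same_space_trans.

Definition spaces : Type := {eq_quot same_space}.
HB.instance Definition _ := Choice.on spaces.
HB.instance Definition _ := EqQuotient.on spaces.

Definition space_of (s : S) : spaces := \pi_spaces s.

Definition space (phi : spaces) : completeNormedModType R := E (repr phi).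

Lemma space_ofP (s t : S) : space_of s = space_of t <-> E s = E t.
Proof.
split=> [/eqP|st]; first by rewrite /space_of eqmodE => /asboolP.
by apply/eqP; rewrite /space_of eqmodE; exact/asboolP.
Qed.

Lemma spaceE (s : S) : E s = space (space_of s).
Proof. by apply/space_ofP; rewrite /space_of reprK. Qed.

HB.instance Definition _ := isPointed.Build spaces (space_of point).
HB.instance Definition _ := @isMeasurable.Build default_measure_display
  spaces discrete_measurable discrete_measurable0
  discrete_measurableC discrete_measurableU.

Definition coproduct : Type := {phi : spaces & space phi}.
HB.instance Definition _ := Topological.copy coproduct {phi : spaces & space phi}.
Definition inj_space (phi : spaces) (x : space phi) : coproduct :=
  existT (fun phi => space phi) phi x.

HB.instance Definition _ :=
  isPointed.Build coproduct (@inj_space point 0).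

Definition borel_coproduct := g_sigma_algebraType (@open coproduct).

Definition section : Type := forall s : S, E s.

Definition to_coproduct (sigma : section) (s : S) : coproduct :=
  inj_space (cast_space (spaceE s) (sigma s)).

Definition fiber (F : completeNormedModType R) : set S := [set s | E s = F].

Definition measurable_family := measurable_fun [set: S] space_of.

Definition discrete_family (mu : {measure set S -> \bar R}) :=
  mu [set s | mu (fiber (E s)) = 0%E] = 0%E.

Definition measurable_section (sigma : section) :=
  measurable_fun [set: S] (to_coproduct sigma : S -> borel_coproduct).

Definition nonzero_values (sigma : section) : set coproduct :=
  [set to_coproduct sigma s | s in [set s | sigma s != 0]].

Definition strongly_measurable (sigma : section) :=
  measurable_section sigma /\ separable_set (nonzero_values sigma).

End family.

Section cast_space.
Context (R : realType) (F G : completeNormedModType R) (e : F = G).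

Lemma cast_spaceD (x y : F) :
  cast_space e (x + y) = cast_space e x + cast_space e y.
Proof. by case: _ / e. Qed.

Lemma cast_spaceZ (a : R) (x : F) :
  cast_space e (a *: x) = a *: cast_space e x.
Proof. by case: _ / e. Qed.

Lemma norm_cast_space (x : F) : `|cast_space e x| = `|x|.
Proof. by case: _ / e. Qed.

Lemma cast_space_eq0 (x : F) : (cast_space e x == 0) = (x == 0).
Proof. by case: _ / e. Qed.

End cast_space.

Section coproduct_facts.
Context (R : realType) d (S : measurableType d).
Variable E : S -> completeNormedModType R.
Local Notation Omega := (coproduct E).
Implicit Types (w a b : Omega) (U : set Omega).

Local Notation pt := (@inj_space R d S E _).

Let fib w : space (projT1 w) := projT2 w.

Let pt_inj phi : injective (@inj_space _ _ _ E phi).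
Proof. by move=> x y xy; exact: (eq_from_Tagged xy). Qed.

Let openP U : open U <-> forall phi, open (@inj_space _ _ _ E phi @^-1` U).
Proof. exact: sigT_openP. Qed.

Let pt_ptE w : w = pt (fib w). Proof. by case: w. Qed.

Definition coball (a : Omega) (r : R) : set Omega :=
  [set inj_space x | x in ball (fib a) r].

Lemma coballP phi (x y : space phi) r : coball (pt x) r (pt y) <-> ball x r y.
Proof.
split=> [[z/= xz zy]|xy]; last by exists y.
by rewrite -(pt_inj zy).
Qed.

Lemma coball_open a r : 0 < r -> open (coball a r).
Proof. by move=> r0; apply: existT_open_map; exact: ball_open. Qed.

Lemma coball_center a r : 0 < r -> coball a r a.
Proof. by move=> r0; rewrite {2}(pt_ptE a); exists (fib a) => //; exact: ballxx. Qed.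

Definition cozero : set Omega := [set w | fib w = 0].

Lemma open_cozeroC : open (~` cozero).
Proof.
apply/openP => phi; rewrite (_ : _ @^-1` _ = ~` [set 0]).
  by apply: closed_openC; apply: accessible_closed_set1; apply: hausdorff_accessible; exact: norm_hausdorff.
by apply/seteqP; split.
Qed.

Lemma separable_setP (A : set Omega) :
  separable_set A <-> exists2 C : set Omega, countable C & A `<=` closure C.
Proof.
split=> [[C [_ cC AC]]|[C cC AC]]; first by exists C.
pose P (c : Omega * nat) := A `&` coball c.1 c.2.+1%:R^-1.
pose g c := xget point (P c).
exists [set g c | c in [set c | C c.1 /\ P c !=set0]]; split.
- move=> _ [c [_ [w Pw]] <-].
  by have [] := xgetPex point (ex_intro _ w Pw).
- apply: (sub_countable (card_image_le _ _)).
  apply: (@sub_countable _ _ _ (C `*` [set: nat])).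
    by apply: subset_card_le => c [].
  exact: countableX.
- move=> w Aw B wB.
  case: w Aw wB => phi x Aw wB.
  have [e e0 eB] : exists2 e : R, 0 < e & ball x e `<=` @inj_space _ _ _ E phi @^-1` B.
    by move: wB; rewrite /nbhs/= sigT_nbhsE => /nbhs_ballP[e e0 eB]; exists e.
  have [n ne] : exists n : nat, n.+1%:R^-1 < e / 2.
    have e20 : 0 < e / 2 by rewrite divr_gt0.
    by have [n] := ltr_add_invr e20; rewrite add0r => ne; exists n.
  have n0 : 0 < n.+1%:R^-1 :> R by rewrite invr_gt0.
  have xn : nbhs (pt x) (coball (pt x) n.+1%:R^-1).
    by apply: open_nbhs_nbhs; split; [exact: coball_open|exact: coball_center].
  have [c [Cc xc]] := AC _ Aw _ xn.
  have [y xy yc] := xc.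
  have Pcn : P (c, n) !=set0.
    exists (pt x); split => //.
    by rewrite -yc; apply/coballP; exact: ball_sym.
  exists (g (c, n)); split; first by exists (c, n).
  have [_] := xgetPex point Pcn.
  rewrite -/(g _) -yc => -[z/= yz <-].
  apply: eB; apply: (@le_ball _ _ _ (n.+1%:R^-1 + n.+1%:R^-1)).
    by rewrite [leRHS]splitr lerD// ltW.
  exact: ball_triangle xy yz.
Qed.

End coproduct_facts.

Section section_lmodule.
Context (R : realType) d (S : measurableType d).
Variable E : S -> completeNormedModType R.
Local Notation section := (section E).

HB.instance Definition _ := gen_eqMixin section.
HB.instance Definition _ := gen_choiceMixin section.

Let add (f g : section) : section := fun s => f s + g s.
Let opp (f : section) : section := fun s => - f s.
Let zero : section := fun=> 0.
Let scale (a : R) (f : section) : section := fun s => a *: f s.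

Let addA : associative add.
Proof. by move=> f g h; apply: functional_extensionality_dep => s; exact: addrA. Qed.

Let addC : commutative add.
Proof. by move=> f g; apply: functional_extensionality_dep => s; exact: addrC. Qed.

Let add0 : left_id zero add.
Proof. by move=> f; apply: functional_extensionality_dep => s; exact: add0r. Qed.

Let addN : left_inverse zero opp add.
Proof. by move=> f; apply: functional_extensionality_dep => s; exact: addNr. Qed.

HB.instance Definition _ := GRing.isZmodule.Build section addA addC add0 addN.

Let scaleA a b f : scale a (scale b f) = scale (a * b) f.
Proof. by apply: functional_extensionality_dep => s; exact: scalerA. Qed.

Let scale1 : left_id 1 scale.
Proof. by move=> f; apply: functional_extensionality_dep => s; exact: scale1r. Qed.

Let scaleDr : right_distributive scale +%R.
Proof. by move=> a f g; apply: functional_extensionality_dep => s; exact: scalerDr. Qed.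

Let scaleDl f : {morph scale^~ f : a b / a + b}.
Proof. by move=> a b; apply: functional_extensionality_dep => s; exact: scalerDl. Qed.

HB.instance Definition _ := GRing.Zmodule_isLmodule.Build R section
  scaleA scale1 scaleDr scaleDl.

Lemma addsE (f g : section) s : (f + g) s = f s + g s. Proof. by []. Qed.
Lemma oppsE (f : section) s : (- f) s = - f s. Proof. by []. Qed.
Lemma zerosE s : (0 : section) s = 0. Proof. by []. Qed.
Lemma scalesE a (f : section) s : (a *: f) s = a *: f s. Proof. by []. Qed.

End section_lmodule.

Section strongly_measurable.
Context (R : realType) d (S : measurableType d).
Variable E : S -> completeNormedModType R.
Local Notation Omega := (coproduct E).
Local Notation pt := (@inj_space R d S E _).
Implicit Types sigma tau : section E.

Let openP (U : set Omega) :
  open U <-> forall phi, open (@inj_space _ _ _ E phi @^-1` U).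
Proof. exact: sigT_openP. Qed.

Lemma measurable_sectionP sigma : measurable_section sigma <->
  forall U : set Omega, open U -> measurable (to_coproduct sigma @^-1` U).
Proof.
split=> [ms U oU|ms].
  rewrite -[X in measurable X]setTI.
  apply: (ms measurableT U); exact: sub_sigma_algebra.
apply: (@measurability _ _ _ (borel_coproduct E) _ _ (@open Omega)) => //.
move=> _ [U oU <-].
by rewrite setTI; exact: ms.
Qed.

Lemma to_coproduct_cozero sigma s : cozero (to_coproduct sigma s) <-> sigma s = 0.
Proof.
rewrite /cozero /to_coproduct /=; split => /eqP; first by rewrite cast_space_eq0 => /eqP.
by rewrite -(cast_space_eq0 (spaceE E s)) => /eqP.
Qed.

Lemma measurable_section_neq0 sigma : measurable_section sigma ->
  measurable [set s | sigma s != 0].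
Proof.
move=> /measurable_sectionP ms.
rewrite (_ : [set _ | _] = to_coproduct sigma @^-1` (~` @cozero _ _ _ E)).
  by apply: ms; exact: open_cozeroC.
apply/seteqP; split=> [s /= s0 /to_coproduct_cozero s00|s /= s0].
  by rewrite s00 eqxx in s0.
by apply/eqP => s00; apply: s0; exact/to_coproduct_cozero.
Qed.

Lemma measurable_norm_section sigma : measurable_section sigma ->
  measurable_fun [set: S] (fun s => `|sigma s|).
Proof.
move=> /measurable_sectionP ms.
apply: (measurability _ (measurable_realfun.RGenOpens.measurableE R)) => _ [_ [a [b ->]] <-].
rewrite setTI; set U := `]a, b[%classic.
have -> : (fun s => `|sigma s|) @^-1` U =
    to_coproduct sigma @^-1` [set w : Omega | U `|(projT2 w : space (projT1 w))|].
  by apply/seteqP; split=> s /=; rewrite norm_cast_space.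
apply: ms; apply/openP => phi.
apply: (@open_comp _ _ (fun x : space phi => `|x|)); last exact: interval_open.
by move=> x _; exact: norm_continuous.
Qed.

Lemma strongly_measurable0 : measurable_family E ->
  strongly_measurable (0 : section E).
Proof.
move=> mE; split.
  apply/measurable_sectionP => U oU.
  have -> : to_coproduct (0 : section E) @^-1` U = [set: S] `&` space_of E @^-1`
      [set phi | U (pt (0 : space phi))].
    rewrite setTI; apply/seteqP; split=> s /=; rewrite /to_coproduct zerosE.
      by have /eqP -> : cast_space (spaceE E s) 0 == 0 by rewrite cast_space_eq0.
    by have /eqP -> : cast_space (spaceE E s) 0 == 0 by rewrite cast_space_eq0.
  exact: mE.
exists set0; split => //.
by move=> w [s]; rewrite /= eqxx.
Qed.

Lemma strongly_measurableZ a sigma :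
  strongly_measurable sigma -> strongly_measurable (a *: sigma).
Proof.
move=> [/measurable_sectionP ms /separable_setP[C cC sC]].
pose sc (w : Omega) : Omega := pt (a *: (projT2 w : space (projT1 w))).
have tcZ s : to_coproduct (a *: sigma) s = sc (to_coproduct sigma s).
  by rewrite /to_coproduct /sc /= scalesE cast_spaceZ.
have sco U : open U -> open (sc @^-1` U).
  move=> /openP oU; apply/openP => phi.
  apply: (@open_comp _ _ (fun x : space phi => a *: x)
    (@inj_space _ _ _ E phi @^-1` U)); last exact: oU.
  by move=> x _; exact: scaler_continuous.
split.
  apply/measurable_sectionP => U oU.
  have -> : to_coproduct (a *: sigma) @^-1` U = to_coproduct sigma @^-1` (sc @^-1` U).
    by apply/seteqP; split=> s /=; rewrite tcZ.
  by apply: ms; exact: sco.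
apply/separable_setP; exists (sc @` C).
  exact: (sub_countable (card_image_le _ _)).
move=> _ [s /= s0 <-] B.
rewrite nbhsE => -[U [oU Us] UB].
have ss0 : sigma s != 0.
  by apply: contra s0 => /eqP ss0; rewrite scalesE ss0 scaler0.
have [||c [Cc Uc]] := sC (to_coproduct sigma s) _ (sc @^-1` U).
- by exists s.
- by apply: open_nbhs_nbhs; split; [exact: sco|rewrite /= -tcZ].
- by exists (sc c); split; [exists c|exact: UB].
Qed.

Let coadd_rel (a b : Omega) : set Omega :=
  [set w | exists phi (x y : space phi), [/\ a = pt x, b = pt y & w = pt (x + y)]].

Let countable_coadd_rel a b : countable (coadd_rel a b).
Proof.
have [->|/set0P[w0 [phi [x [y [ax bx w0E]]]]]] := eqVneq (coadd_rel a b) set0.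
  exact: countable0.
apply: (@sub_countable _ _ _ [set w0]); last exact: countable1.
apply: subset_card_le => _ [psi [x' [y' [ax' bx' ->]]]] /=.
have pp : phi = psi by have := congr1 (@projT1 _ _) ax'; rewrite ax.
case: _ / pp x' y' ax' bx' => x' y' ax' bx'.
rewrite w0E; congr (pt (_ + _)).
  exact: (eq_from_Tagged (etrans (esym ax') ax)).
exact: (eq_from_Tagged (etrans (esym bx') bx)).
Qed.

(* [coball a r + coball b r], fibrewise, is contained in [U] *)
Let coadd_sub (a b : Omega) r (U : set Omega) :=
  forall phi (x y : space phi), coball a r (pt x) -> coball b r (pt y) ->
    U (pt (x + y)).

Let coaddP phi (x y : space phi) (U : set Omega) : nbhs (pt (x + y)) U ->
  exists n : nat, coadd_sub (pt x) (pt y) (n.+1%:R^-1 *+ 2) U.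
Proof.
rewrite /nbhs/= sigT_nbhsE => /nbhs_ballP[e /= e0 eU].
have [n ne] : exists n : nat, n.+1%:R^-1 < e / 4.
  have e40 : 0 < e / 4 by rewrite divr_gt0.
  by have [n] := ltr_add_invr e40; rewrite add0r => ne; exists n.
exists n => psi x' y' xx' yy'.
have pp : phi = psi by case: xx' => z _ /(congr1 (@projT1 _ _)).
case: _ / pp x' y' xx' yy' => x' y' /coballP xx' /coballP yy'.
apply: eU; rewrite -ball_normE /ball_/= opprD addrACA.
rewrite (le_lt_trans (ler_normD _ _))//.
move: xx' yy'; rewrite -ball_normE /ball_/= => xx' yy'.
rewrite (lt_le_trans (ltrD xx' yy'))// -mulrnDr.
by rewrite -[leLHS]mulr_natr -ler_pdivlMr// ltW.
Qed.

Let countable_setU (T : Type) (A B : set T) :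
  countable A -> countable B -> countable (A `|` B).
Proof.
move=> cA cB; rewrite -bigcup2E; apply: bigcup_countable => [|[|[|n]] _] //.
Qed.

Lemma strongly_measurableD sigma tau :
  strongly_measurable sigma -> strongly_measurable tau ->
  strongly_measurable (sigma + tau).
Proof.
move=> [ms /separable_setP[C cC sC]] [mt /separable_setP[D cD tD]].
have tcD s : to_coproduct (sigma + tau) s =
    pt (cast_space (spaceE E s) (sigma s) + cast_space (spaceE E s) (tau s)).
  by rewrite /to_coproduct addsE cast_spaceD.
have approx s U : sigma s != 0 -> tau s != 0 -> open U ->
    U (to_coproduct (sigma + tau) s) ->
    exists n (x y : space (space_of E s)), [/\ C (pt x), D (pt y),
      coball (pt x) n.+1%:R^-1 (to_coproduct sigma s),
      coball (pt y) n.+1%:R^-1 (to_coproduct tau s) &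
      coadd_sub (pt x) (pt y) n.+1%:R^-1 U].
  move=> s0 t0 oU; rewrite tcD => Us.
  have [n nU] : exists n, coadd_sub (to_coproduct sigma s) (to_coproduct tau s)
    (n.+1%:R^-1 *+ 2) U by apply: coaddP; exact: open_nbhs_nbhs.
  have n0 : 0 < n.+1%:R^-1 :> R by rewrite invr_gt0.
  have nb (w : Omega) : nbhs w (coball w n.+1%:R^-1).
    by apply: open_nbhs_nbhs; split; [exact: coball_open|exact: coball_center].
  have [|a [Ca [x sx ax]]] := sC (to_coproduct sigma s) _ _ (nb _); first by exists s.
  have [|b [Db [y ty bx]]] := tD (to_coproduct tau s) _ _ (nb _); first by exists s.
  exists n, x, y; split; [by rewrite ax|by rewrite bx| | |].
  - by apply/coballP; exact: ball_sym.
  - by apply/coballP; exact: ball_sym.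
  - move=> phi z w az bw.
    apply: nU.
      case: az => z' xz' <-; apply/coballP; rewrite mulr2n.
      exact: ball_triangle sx xz'.
    case: bw => w' yw' <-; apply/coballP; rewrite mulr2n.
    exact: ball_triangle ty yw'.
split; last first.
  pose A := C `|` D `|` \bigcup_(c in C `*` D) coadd_rel c.1 c.2.
  apply/separable_setP; exists A.
    apply: countable_setU; first exact: countable_setU.
    by apply: bigcup_countable => [|c _]; [exact: countableX|].
  move=> _ [s /= st0 <-] B.
  rewrite nbhsE => -[U [oU Us] UB].
  have [s0|s0] := eqVneq (sigma s) 0.
    have gst : to_coproduct (sigma + tau) s = to_coproduct tau s.
      by rewrite /to_coproduct addsE s0 add0r.
    have [||c [Dc Uc]] := tD (to_coproduct tau s) _ U.
    - by exists s => //=; move: st0; rewrite addsE s0 add0r.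
    - by apply: open_nbhs_nbhs; split => //; rewrite -gst.
    - by exists c; split; [left; right|exact: UB].
  have [t0|t0] := eqVneq (tau s) 0.
    have gst : to_coproduct (sigma + tau) s = to_coproduct sigma s.
      by rewrite /to_coproduct addsE t0 addr0.
    have [||c [Cc Uc]] := sC (to_coproduct sigma s) _ U.
    - by exists s.
    - by apply: open_nbhs_nbhs; split => //; rewrite -gst.
    - by exists c; split; [left; left|exact: UB].
  have [n [x [y [Cx Dy _ _ xyU]]]] := approx s U s0 t0 oU Us.
  have n0 : 0 < n.+1%:R^-1 :> R by rewrite invr_gt0.
  exists (pt (x + y)); split; last by apply/UB/xyU; exact: coball_center.
  right; exists (pt x, pt y) => //=.
  by exists (space_of E s), x, y.
have ns := measurable_section_neq0 ms.
have nt := measurable_section_neq0 mt.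
move/measurable_sectionP : ms => ms; move/measurable_sectionP : mt => mt.
apply/measurable_sectionP => U oU.
pose I := [set i : nat * (Omega * Omega) |
  [/\ C i.2.1, D i.2.2 & coadd_sub i.2.1 i.2.2 i.1.+1%:R^-1 U]].
pose V (i : nat * (Omega * Omega)) :=
  to_coproduct sigma @^-1` (coball i.2.1 i.1.+1%:R^-1) `&`
  to_coproduct tau @^-1` (coball i.2.2 i.1.+1%:R^-1).
have -> : to_coproduct (sigma + tau) @^-1` U =
    (~` [set s | tau s != 0] `&` to_coproduct sigma @^-1` U) `|`
    (~` [set s | sigma s != 0] `&` to_coproduct tau @^-1` U) `|`
    ([set s | sigma s != 0] `&` [set s | tau s != 0] `&` \bigcup_(i in I) V i).
  apply/seteqP; split=> s /=.
    have [t0|t0] := eqVneq (tau s) 0.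
      by rewrite /to_coproduct addsE t0 addr0 => Us; left; left; split => //; exact/negP.
    have [s0|s0] := eqVneq (sigma s) 0.
      by rewrite /to_coproduct addsE s0 add0r => Us; left; right; split => //; exact/negP.
    move=> /(approx s U s0 t0 oU)[n [x [y [Cx Dy xs yt xyU]]]].
    by right; split => //; exists (n, (pt x, pt y)).
  move=> [[[/negP/negPn/eqP t0]|[/negP/negPn/eqP s0]]|[_ [[n [a b]]]]].
  - by rewrite /to_coproduct addsE t0 addr0.
  - by rewrite /to_coproduct addsE s0 add0r.
  - by move=> [/= _ _ abU] [/= as_ bt]; rewrite tcD; exact: abU.
apply: measurableU; first apply: measurableU.
- by apply: measurableI; [exact: measurableC|exact: ms].
- by apply: measurableI; [exact: measurableC|exact: mt].
- apply: measurableI; first exact: measurableI.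
  rewrite bigcup_set_type; apply: countable_bigcupT_measurable => [|i].
    rewrite (eq_countable (card_setT _)).
    apply: (@sub_countable _ _ _ ([set: nat] `*` (C `*` D))).
      by apply: subset_card_le => i [].
    by apply: countableX => //; exact: countableX.
  have n0 (n : nat) : 0 < n.+1%:R^-1 :> R by rewrite invr_gt0.
  by apply: measurableI; [apply: ms|apply: mt]; exact: coball_open.
Qed.

End strongly_measurable.

Section direct_integral.
Context (R : realType) d (S : measurableType d).
Variables (mu : {measure set S -> \bar R}).
Variables (E : S -> completeNormedModType R) (mE : measurable_family E).
Variables (p : \bar R) (p1 : (1 <= p)%E).
Implicit Types sigma tau : section E.

Definition section_norm sigma : \bar R := Lnorm mu p (fun s => `|sigma s|%:E).

(* The proofs are arguments because being a submodule depends on them. *)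
Definition Lp_pred (_ : measurable_family E) (_ : (1 <= p)%E) :
    {pred section E} :=
  fun sigma => `[< strongly_measurable sigma /\ (section_norm sigma < +oo)%E >].

Let Lp_predP sigma : reflect
  (strongly_measurable sigma /\ (section_norm sigma < +oo)%E)
  (sigma \in Lp_pred mE p1).
Proof. exact: asboolP. Qed.

Let mnorm sigma : strongly_measurable sigma ->
  measurable_fun [set: S] (fun s => `|sigma s|).
Proof. by move=> [? _]; exact: measurable_norm_section. Qed.

Let p_gt0 : (0 < p)%E. Proof. exact: lt_le_trans p1. Qed.

Lemma section_norm0 : section_norm 0 = 0%E.
Proof.
rewrite -[RHS](Lnorm0 mu (p := p)) ?gt_eqF//; apply: eq_Lnorm => s.
by rewrite zerosE normr0.
Qed.

Lemma le_Lnorm (f g : S -> R) : measurable_fun setT f -> measurable_fun setT g ->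
  (forall s, 0 <= f s <= g s) -> (Lnorm mu p (EFin \o f) <= Lnorm mu p (EFin \o g))%E.
Proof.
move=> mf mg fg; rewrite unlock /Lnorm; case: p p1 => //= [r|_].
  rewrite lee_fin => r1; have r0 : 0 <= r by rewrite (le_trans _ r1).
  apply: gt0_ler_poweR; rewrite ?invr_ge0//.
  - by rewrite in_itv /= leey integral_ge0.
  - by rewrite in_itv /= leey integral_ge0.
  apply: ge0_le_integral => //.
  - apply/measurable_EFinP; apply: (@measurableT_comp _ _ _ _ _ _ (@powR R ^~ r)) => //.
    exact: measurableT_comp.
  - apply/measurable_EFinP; apply: (@measurableT_comp _ _ _ _ _ _ (@powR R ^~ r)) => //.
    exact: measurableT_comp.
  - move=> s _; have /andP[f0 fgs] := fg s; rewrite lee_fin.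
    apply: ge0_ler_powR; rewrite ?nnegrE ?normr_ge0//.
    by rewrite !ger0_norm// (le_trans f0).
case: ifPn => // _; apply: le_ess_sup; apply: nearW => s /=.
by have /andP[f0 fgs] := fg s; rewrite lee_fin !ger0_norm// (le_trans f0).
Qed.

Lemma Lnorm_ae_eq0 (f : S -> R) : measurable_fun setT f ->
  {ae mu, forall s, f s = 0} -> Lnorm mu p (EFin \o f) = 0%E.
Proof.
move=> mf f0; rewrite unlock /Lnorm; case: p p1 => //= [r|_].
  rewrite lee_fin => r1; have r0 : 0 < r by rewrite (lt_le_trans _ r1).
  rewrite (_ : (\int[mu]_x _ = 0)%E) ?poweR0r// ?invr_neq0 ?gt_eqF//.
  rewrite -(integral0 mu setT); apply: ae_eq_integral => //.
    apply/measurable_EFinP; apply: (@measurableT_comp _ _ _ _ _ _ (@powR R ^~ r)) => //.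
    exact: measurableT_comp.
  by apply: filterS f0 => s fs0 _ /=; rewrite fs0 normr0 powR0// gt_eqF.
case: ifPn => // mu0; apply: ess_sup_ae_cst => //.
by apply: filterS f0 => s fs0 /=; rewrite fs0 normr0.
Qed.

Lemma ler_section_normD sigma tau :
  strongly_measurable sigma -> strongly_measurable tau ->
  (section_norm (sigma + tau)%R <= section_norm sigma + section_norm tau)%E.
Proof.
move=> ms mt; apply: (le_trans _ (eminkowski mu (mnorm ms) (mnorm mt) p1)).
apply: le_Lnorm.
- exact/mnorm/strongly_measurableD.
- by apply: measurable_funD; exact: mnorm.
- by move=> s; rewrite normr_ge0 addsE ler_normD.
Qed.

Lemma section_normZ a sigma : sigma \in Lp_pred mE p1 ->
  section_norm (a *: sigma) = (`|a|%:E * section_norm sigma)%E.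
Proof.
move=> /Lp_predP[ms fs].
have Lf : (fun s => `|sigma s|) \in Lfun mu p.
  by apply/andP; split; apply/mem_set => //; exact: mnorm.
have := LnormZ (Lfun_Sub p1 Lf) `|a|; rewrite normr_id => <-.
by apply: eq_Lnorm => s; rewrite scalesE normrZ.
Qed.

Lemma Lp_pred_submod_closed : submod_closed (Lp_pred mE p1).
Proof.
split.
  by apply/Lp_predP; split; [exact: strongly_measurable0|rewrite section_norm0].
move=> a sigma tau sL /Lp_predP[mt ft].
have /Lp_predP[ms fs] := sL; apply/Lp_predP; split.
  by apply: strongly_measurableD => //; exact: strongly_measurableZ.
rewrite (le_lt_trans (ler_section_normD _ _))//.
  exact: strongly_measurableZ.
by rewrite lte_add_pinfty// section_normZ// lte_mul_pinfty// lee_fin.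
Qed.

HB.instance Definition _ := GRing.isSubmodClosed.Build R (section E)
  (Lp_pred mE p1) Lp_pred_submod_closed.

Definition Lp_section : Type := {sigma : section E | sigma \in Lp_pred mE p1}.
HB.instance Definition _ := SubChoice.on Lp_section.
HB.instance Definition _ := [SubChoice_isSubLmodule of Lp_section by <:].

Definition null_section : {pred Lp_section} :=
  fun f => `[< {ae mu, forall s, val f s = 0} >].

Lemma null_section_submod_closed : submod_closed null_section.
Proof.
split; first by apply/asboolP; apply: nearW.
move=> a f g /asboolP f0 /asboolP g0; apply/asboolP.
apply: filterS2 f0 g0 => s f0 g0.
have -> : val (a *: f + g) s = a *: val f s + val g s by [].
by rewrite f0 g0 scaler0 addr0.
Qed.

HB.instance Definition _ := GRing.isSubmodClosed.Build R Lp_section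
  null_section null_section_submod_closed.

Definition direct_integral : Type := Quotient.quot null_section.
HB.instance Definition _ := GRing.Zmodule.on direct_integral.
HB.instance Definition _ := EqQuotient.on direct_integral.

Implicit Types (f g : Lp_section) (x y : direct_integral).

Definition dclass f : direct_integral := \pi_direct_integral f.

Lemma dclassP f g : dclass f = dclass g <-> {ae mu, forall s, val f s = val g s}.
Proof.
have <- : (f - g \in null_section) <-> {ae mu, forall s, val f s = val g s}.
  split=> [/asboolP|] fg; last apply/asboolP; apply: filterS fg => s.
    have -> : val (f - g) s = val f s - val g s by [].
    by move=> /eqP; rewrite subr_eq0 => /eqP.
  have -> : val (f - g) s = val f s - val g s by [].
  by move=> ->; rewrite subrr.
by split => [/eqP|fg]; [|apply/eqP]; rewrite /dclass /direct_integral
  -Quotient.idealrBE.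
Qed.

Lemma dclass_repr x : dclass (repr x) = x. Proof. exact: reprK. Qed.

Lemma dclassD f g : dclass (f + g) = dclass f + dclass g.
Proof. exact: Quotient.pi_add. Qed.

Let scale a x : direct_integral := dclass (a *: repr x).

Let scale_class a f : scale a (dclass f) = dclass (a *: f).
Proof.
apply/dclassP; have /dclassP : dclass (repr (dclass f)) = dclass f by rewrite dclass_repr.
apply: filterS => s fE.
have -> : val (a *: repr (dclass f)) s = a *: val (repr (dclass f)) s by [].
by rewrite fE.
Qed.

Let scaleA a b x : scale a (scale b x) = scale (a * b) x.
Proof. by rewrite -(dclass_repr x) !scale_class scalerA. Qed.

Let scale1 : left_id 1 scale.
Proof. by move=> x; rewrite -(dclass_repr x) scale_class scale1r. Qed.

Let scaleDr : right_distributive scale +%R.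
Proof.
move=> a x y; rewrite -(dclass_repr x) -(dclass_repr y) -dclassD !scale_class.
by rewrite scalerDr dclassD.
Qed.

Let scaleDl x : {morph scale^~ x : a b / a + b}.
Proof.
by move=> a b; rewrite -(dclass_repr x) !scale_class scalerDl dclassD.
Qed.

HB.instance Definition _ := GRing.Zmodule_isLmodule.Build R direct_integral
  scaleA scale1 scaleDr scaleDl.

Lemma dclassZ a f : dclass (a *: f) = a *: dclass f.
Proof. by rewrite -scale_class. Qed.

Lemma section_norm_fin f : section_norm (val f) \is a fin_num.
Proof.
have /Lp_predP[_ foo] := valP f.
by rewrite ge0_fin_numE// Lnorm_ge0.
Qed.

Lemma section_norm_eq0 f :
  section_norm (val f) = 0%E <-> {ae mu, forall s, val f s = 0}.
Proof.
have /Lp_predP[mf _] := valP f.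
have mnf : measurable_fun setT (fun s => `|val f s|%:E).
  by apply/measurable_EFinP; exact: mnorm.
split=> [/(Lnorm_eq0_eq0 mnf p_gt0)|f0].
  by apply: filterS => s /(_ I) [] /eqP; rewrite normr_eq0 => /eqP.
apply: (@Lnorm_ae_eq0 (fun s => `|val f s|)); first exact: mnorm.
by apply: filterS f0 => s ->; rewrite normr0.
Qed.

Definition dinorm x : R := fine (section_norm (val (repr x))).

Lemma dinorm_dclass f : dinorm (dclass f) = fine (section_norm (val f)).
Proof.
suff le_class g h : dclass g = dclass h ->
    fine (section_norm (val g)) <= fine (section_norm (val h)).
  by apply/eqP; rewrite eq_le !le_class// dclass_repr.
move=> /dclassP gh; rewrite -lee_fin !fineK ?section_norm_fin//.
have /Lp_predP[mh _] := valP h.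
have /Lp_predP[mgh _] := valP (g - h).
have /section_norm_eq0 gh0 : {ae mu, forall s, val (g - h) s = 0}.
  apply: filterS gh => s gh.
  have -> : val (g - h) s = val g s - val h s by [].
  by rewrite gh subrr.
have -> : val g = val (g - h) + val h.
  by rewrite -[in LHS](subrK h g).
by rewrite (le_trans (ler_section_normD mgh mh))// gh0 add0e.
Qed.

Lemma ler_dinormD x y : dinorm (x + y) <= dinorm x + dinorm y.
Proof.
rewrite -(dclass_repr x) -(dclass_repr y) -dclassD !dinorm_dclass.
rewrite -lee_fin EFinD !fineK ?section_norm_fin//.
have /Lp_predP[mx _] := valP (repr x).
have /Lp_predP[my _] := valP (repr y).
exact: ler_section_normD mx my.
Qed.

Lemma dinormZ a x : dinorm (a *: x) = `|a| * dinorm x.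
Proof.
rewrite -(dclass_repr x) -dclassZ !dinorm_dclass.
have -> : val (a *: repr x) = a *: val (repr x) by [].
rewrite section_normZ ?fineM//; first exact: section_norm_fin.
exact: valP.
Qed.

Lemma dinorm0_eq0 x : dinorm x = 0 -> x = 0.
Proof.
move=> x0; have /section_norm_eq0 rx0 : section_norm (val (repr x)) = 0%E.
  by rewrite -[LHS]fineK ?section_norm_fin// -/(dinorm x) x0.
have <- : dclass 0 = 0 by apply: (addrI (dclass 0)); rewrite -dclassD !addr0.
by rewrite -(dclass_repr x); apply/dclassP.
Qed.

HB.instance Definition _ := Lmodule_isNormed.Build R direct_integral
  ler_dinormD dinormZ dinorm0_eq0.

Lemma norm_dclass f : `|dclass f| = fine (section_norm (val f)).
Proof. exact: dinorm_dclass. Qed.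

End direct_integral.

Lemma ltr1_lee1 (R : realType) (p : R) : 1 < p -> (1 <= p%:E)%E.
Proof. by rewrite lee_fin => /ltW. Qed.

(* Main.v *)
Require Import Defs.
From mathcomp Require Import all_boot all_order all_algebra.
From mathcomp Require Import all_classical all_reals all_analysis.
From mathcomp Require Import measurable_realfun ring lra.
Set Implicit Arguments.
Unset Strict Implicit.
Unset Printing Implicit Defensive.
Import Order.TTheory GRing.Theory Num.Theory.
Import numFieldNormedType.Exports.
Local Open Scope classical_set_scope.
Local Open Scope ring_scope.

(* A normed space is strictly convex iff two unit vectors whose midpoint is a
   unit vector are equal.

   If almost all E_s are strictly convex, let f, g and (f + g) / 2 have norm 1
   in the direct integral. Integrating
     |(f + g) / 2|^p <= ((|f| + |g|) / 2)^p <= (|f|^p + |g|^p) / 2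
   gives 1 on both ends, so both inequalities are equalities almost everywhere.
   As p > 1, the second one forces |f| = |g|, and then the first one is the
   equality case of the midpoint criterion in E_s, whence f = g.

   Conversely, by discreteness almost every E_t occurs on a set of positive
   measure, which by sigma-finiteness contains a set A with 0 < mu A < +oo.
   Sending x in E_t to the section equal to x on A and to 0 elsewhere embeds
   E_t, up to a scalar factor isometrically, into the direct integral, and
   strict convexity passes to subspaces. *)

(** * Strict midpoint convexity of the power function *)

Section powR_strict_convexity.
Context (R : realType).
Implicit Types (p a b y : R).

Lemma powR_gt1D p y : 1 < p -> 0 <= y -> y != 1 -> 1 + p * (y - 1) < y `^ p.
Proof.
move=> p1; rewrite le_eqVlt => /predU1P[<- _|y0 y1].
  by rewrite powR0; lra.
have p0 : 0 < p by lra.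
have z0 : ln y != 0 by rewrite ln_eq0.
(* [expR] lies strictly above its tangent at [ln y], evaluated at [p * ln y]
   and at [0]. *)
have h1 : y * (1 + (p - 1) * ln y) < y `^ p.
  have -> : y `^ p = y * expR ((p - 1) * ln y).
    by rewrite /powR gt_eqF// -{2}(lnK y0) -expRD; congr expR; ring.
  by rewrite ltr_pM2l// expR_gt1Dx// mulf_neq0// gt_eqF//; lra.
have h2 : y * (1 - ln y) < 1.
  have {2}-> : 1 = y * expR (- ln y).
    by rewrite expRN lnK// divff// gt_eqF.
  by rewrite ltr_pM2l// expR_gt1Dx// oppr_eq0.
(* [h2] says [y - 1 < y * ln y]; multiplying by [p - 1] and inserting in [h1] gives the bound. *)
nra.
Qed.

(** Dividing by the midpoint [m] turns [a] and [b] into two points with mean 1. In the sum of the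
    strict Bernoulli inequalities [powR_gt1D] at these points, the linear terms cancel. *)
Lemma powR_mid_lt p a b : 1 < p -> 0 <= a -> 0 <= b -> a != b ->
  ((a + b) / 2) `^ p < (a `^ p + b `^ p) / 2.
Proof.
move=> p1 a0 b0 ab; set m := (a + b) / 2.
have m0 : 0 < m.
  rewrite lt_neqAle /m; apply/andP; split; last by lra.
  apply: contra ab => /eqP h; apply/eqP; lra.
have scale x : 0 <= x -> x `^ p = m `^ p * (x / m) `^ p.
  move=> x0; have xm0 : 0 <= x / m by exact: divr_ge0 x0 (ltW m0).
  by rewrite -(powRM _ (ltW m0) xm0) [m * _]mulrC divfK// gt_eqF.
have tangent x : 0 <= x -> x != m -> 1 + p * (x / m - 1) < (x / m) `^ p.
  move=> x0 xm; apply: (powR_gt1D p1 (divr_ge0 x0 (ltW m0))).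
  apply: contra xm => /eqP h; apply/eqP.
  by rewrite -[x](@divfK _ m) ?h ?mul1r// gt_eqF.
have ta : 1 + p * (a / m - 1) < (a / m) `^ p.
  apply: tangent => //; apply: contra ab => /eqP; rewrite /m => xm.
  by apply/eqP; lra.
have tb : 1 + p * (b / m - 1) < (b / m) `^ p.
  apply: tangent => //; apply: contra ab => /eqP; rewrite /m => xm.
  by apply/eqP; lra.
have abm : a / m + b / m = 2.
  by rewrite -mulrDl [a + b](_ : _ = 2 * m) ?mulfK ?gt_eqF// /m; lra.
rewrite (scale a a0) (scale b b0) -mulrDr -mulrA ltr_pMr ?powR_gt0//.
have : p * (a / m - 1) + p * (b / m - 1) = 0.
  by rewrite -mulrDr (_ : _ + _ = 0) ?mulr0//; lra.
lra.
Qed.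

Lemma powR_mid_le p a b : 1 < p -> 0 <= a -> 0 <= b ->
  ((a + b) / 2) `^ p <= (a `^ p + b `^ p) / 2.
Proof.
move=> p1 a0 b0; have [->|ab] := eqVneq a b; last exact/ltW/powR_mid_lt.
by have half x : (x + x) / 2 = x :> R; [lra|rewrite !half].
Qed.

End powR_strict_convexity.

(** * Strict convexity through midpoints *)

Section midpoint_criterion.
Context (R : realType) (V : normedModType R).

(** The segment from [u] to [v], parametrized by [-1, 1], stays in the unit sphere as soon as its
    midpoint does. Conversely, an affine path is determined by its two endpoints, so it is constant
    when they agree. *)
Lemma strictly_convexP : strictly_convex V <-> forall u v : V,
  `|u| = 1 -> `|v| = 1 -> `|2^-1 *: (u + v)| = 1 -> u = v.
Proof.
split=> [sc u v u1 v1 uv1|mid gamma aff g1].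
  pose gamma (x : R) := ((1 - x) / 2) *: u + ((1 + x) / 2) *: v.
  have g_le1 x : x \in `[-1, 1] -> `|gamma x| <= 1.
    rewrite in_itv/= => /andP[x1 x2]; apply: (le_trans (ler_normD _ _)).
    by rewrite !normrZ u1 v1 !ger0_norm; lra.
  have gammaE x a b : (1 - x) / 2 = a -> (1 + x) / 2 = b ->
    gamma x = a *: u + b *: v by move=> <- <-.
  have gN1 : gamma (-1) = u.
    by rewrite (gammaE _ 1 0) ?scale1r ?scale0r ?addr0//; lra.
  have g1 : gamma 1 = v.
    by rewrite (gammaE _ 0 1) ?scale1r ?scale0r ?add0r//; lra.
  rewrite -gN1 -[RHS]g1; apply: sc;
    rewrite ?in_itv/= ?lexx ?andbT; [| |lra|lra].
  - move=> x y t _ _ _; rewrite /gamma !scalerDr !scalerA addrACA -!scalerDl.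
    by congr (_ *: _ + _ *: _); field.
  (* [gamma x] and [gamma (- x)] lie in the unit ball and their midpoint is that of [u] and [v], of
     norm 1; hence neither norm can be below 1. *)
  - move=> x xI; apply/eqP; rewrite eq_le g_le1//=.
    have NxI : - x \in `[-1, 1] by move: xI; rewrite !in_itv/=; lra.
    have mE : 2^-1 *: (u + v) = 2^-1 *: (gamma x + gamma (- x)).
      have wE (w : V) a b : a + b = 1 -> a *: w + b *: w = w.
        by rewrite -scalerDl => ->; rewrite scale1r.
      by rewrite /gamma addrACA !wE//; field.
    have := ler_normD (gamma x) (gamma (- x)); have := g_le1 _ NxI.
    have : `|gamma x + gamma (- x)| = 2.
      by move: uv1; rewrite mE normrZ ger0_norm ?invr_ge0//; lra.
    lra.
have I_N1 : -1 \in `[-1, 1 : R] by rewrite in_itv/=; lra.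
have I_1 : 1 \in `[-1, 1 : R] by rewrite in_itv/=; lra.
have gE : gamma (-1) = gamma 1.
  apply: mid; rewrite ?g1//.
  have : `|gamma ((1 - 2^-1) * -1 + 2^-1 * 1)| = 1.
    by apply: g1; rewrite in_itv/=; lra.
  rewrite aff//; last lra.
  by have -> : 1 - 2^-1 = 2^-1 :> R; [lra|rewrite -scalerDr].
suff gx x : x \in `[-1, 1] -> gamma x = gamma 1 by move=> x y /gx -> /gx ->.
rewrite in_itv/= => xI.
have {1}-> : x = (1 - (x + 1) / 2) * -1 + (x + 1) / 2 * 1 by field.
rewrite aff//; last lra.
by rewrite gE -scalerDl subrK scale1r.
Qed.

(** Scaling by the inverse of [|v|] reduces to unit vectors. This homogeneous form applies to the
    values of two sections at a point, whose common norm is arbitrary. *)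
Lemma strictly_convex_mid : strictly_convex V -> forall u v : V,
  `|u| = `|v| -> `|2^-1 *: (u + v)| = `|v| -> u = v.
Proof.
move=> /strictly_convexP sc u v uv mid.
have [v0|v0] := eqVneq v 0.
  by apply/eqP; rewrite v0 -normr_eq0 uv v0 normr0.
have nv0 : `|v| != 0 by rewrite normr_eq0.
apply: (@scalerI _ _ `|v|^-1); first by rewrite invr_eq0.
have nV : `| `|v|^-1 | = `|v|^-1 by rewrite ger0_norm.
apply: sc; rewrite -?scalerDr ?scalerA ?[2^-1 * _]mulrC -?scalerA normrZ nV.
- by rewrite uv mulVf.
- by rewrite mulVf.
- by rewrite mid mulVf.
Qed.

End midpoint_criterion.

(** * From almost all spaces to the direct integral *)

Section direct_integral.
Context (R : realType) (d : measure_display) (S : measurableType d).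
Variables (mu : {measure set S -> \bar R}) (E : S -> completeNormedModType R).
Variables (mE : measurable_family E) (p : R) (p1 : 1 < p).
Local Notation Lsection := (Lp_section mu mE (ltr1_lee1 p1)).
Implicit Types f g : Lsection.

Let p0 : 0 < p. Proof. exact: lt_trans p1. Qed.

Lemma Lp_sectionP f :
  strongly_measurable (val f) /\ (section_norm mu p%:E (val f) < +oo)%E.
Proof. exact/asboolP/(valP f). Qed.

Lemma norm_dclass_powR f :
  (`|dclass f| `^ p)%:E = (\int[mu]_s (`|val f s| `^ p)%:E)%E.
Proof.
rewrite -[LHS]poweR_EFin norm_dclass (fineK (section_norm_fin f)).
rewrite (poweR_Lnorm _ _ (lt0r_neq0 p0)).
by apply: eq_integral => s _; rewrite -[RHS]poweR_EFin /= normr_id.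
Qed.

Lemma measurable_norm_powR f :
  measurable_fun [set: S] (fun s => (`|val f s| `^ p)%:E).
Proof.
have [[mf _] _] := Lp_sectionP f; apply/measurable_EFinP.
exact: (measurableT_comp (measurable_powR _)) (measurable_norm_section mf).
Qed.

Lemma norm_dclass_eq1 f :
  `|dclass f| = 1 <-> (\int[mu]_s (`|val f s| `^ p)%:E = 1)%E.
Proof.
rewrite -norm_dclass_powR; split=> [->|[]]; first by rewrite powR1.
move=> /eqP; rewrite powR_eq1 (gt_eqF p0) orbF.
by rewrite ltNge normr_ge0 orbF => /eqP.
Qed.

Lemma ae_norm_mid f g :
  `|dclass f| = 1 -> `|dclass g| = 1 -> `|2^-1 *: (dclass f + dclass g)| = 1 ->
  {ae mu, forall s, `|val f s| = `|val g s| /\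
    `|2^-1 *: (val f s + val g s)| = `|val g s| }.
Proof.
move=> f1 g1; rewrite -dclassD -dclassZ; set m := 2^-1 *: (f + g) => m1.
pose nf s := `|val f s| `^ p; pose ng s := `|val g s| `^ p.
pose nm s := `|val m s| `^ p.
have mE' s : val m s = 2^-1 *: (val f s + val g s) by [].
have norm_m s : `|val m s| <= (`|val f s| + `|val g s|) / 2.
  rewrite mE' normrZ ger0_norm ?invr_ge0// mulrC ler_wpM2r ?invr_ge0//.
  exact: ler_normD.
have norm_m_powR s : nm s <= ((`|val f s| + `|val g s|) / 2) `^ p.
  by apply: ge0_ler_powR;
    rewrite ?nnegrE ?(ltW p0) ?normr_ge0 ?divr_ge0 ?addr_ge0.
have le_mid s : nm s <= (nf s + ng s) / 2.
  exact: le_trans (norm_m_powR s) (powR_mid_le _ _ _).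
have mnf := measurable_norm_powR f; have mng := measurable_norm_powR g.
have mnm := measurable_norm_powR m.
move/norm_dclass_eq1 : f1; rewrite -/(nf _) => f1.
move/norm_dclass_eq1 : g1; rewrite -/(ng _) => g1.
move/norm_dclass_eq1 : m1; rewrite -/(nm _) => m1.
pose h s := (nf s + ng s) / 2 - nm s.
have mh : measurable_fun setT (EFin \o h).
  apply/measurable_EFinP; apply: measurable_funB; last exact/measurable_EFinP.
  apply: measurable_funM => //.
  by apply: measurable_funD; exact/measurable_EFinP.
have h0 s : 0 <= h s by rewrite subr_ge0.
have inth : (\int[mu]_s (h s)%:E = 0)%E.
  (* Instead of a difference, the identity [h + nm = (nf + ng) / 2] between nonnegative functions is
     integrated; the finite integral 1 of [nm] then cancels. *)
  have : (\int[mu]_s ((h s)%:E + (nm s)%:E) =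
          \int[mu]_s (2^-1%:E * ((nf s)%:E + (ng s)%:E)))%E.
    by apply: eq_integral => s _; rewrite -EFinD -EFinM subrK mulrC.
  rewrite ge0_integralD//; [|by move=> s _; rewrite lee_fin ?powR_ge0..].
  rewrite ge0_integralZl_EFin ?invr_ge0//; last 2 first.
    by move=> s _; rewrite lee_fin addr_ge0 ?powR_ge0.
    exact: emeasurable_funD.
  rewrite ge0_integralD//; [|by move=> s _; rewrite lee_fin ?powR_ge0..].
  rewrite [X in (_ + X)%E]m1 [X in (_ * (X + _))%E]f1 [X in (_ * (_ + X))%E]g1.
  rewrite -EFinD -EFinM (_ : 2^-1 * _ = 1 :> R); last by rewrite mulVf.
  by move/(congr1 (fun z => (z - 1)%E)); rewrite addeK// subee.
have {inth} : ae_eq mu setT (EFin \o h) (cst 0%E).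
  apply/ae_eq_integral_abs => //; rewrite -[RHS]inth.
  by apply: eq_integral => s _; rewrite gee0_abs ?lee_fin.
apply: filterS => s /(_ I)[hs].
(* Vanishing of [h s] closes the whole chain of inequalities at [s], so the strict inequality
   [powR_mid_lt] is excluded. *)
have eq_powR : nm s = (nf s + ng s) / 2 by apply/esym/subr0_eq.
have fg : `|val f s| = `|val g s|.
  apply/eqP/negP => /negP fg.
  have := powR_mid_lt p1 (normr_ge0 _) (normr_ge0 _) fg.
  by rewrite ltNge -/(nf s) -/(ng s) -eq_powR norm_m_powR.
split=> //; rewrite -mE'; apply: (@powR_injective _ p p0); rewrite ?nnegrE//.
by rewrite -/(nm s) eq_powR /nf fg -/(ng s); lra.
Qed.

Lemma strictly_convex_direct_integral :
  {ae mu, forall s, strictly_convex (E s)} ->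
  strictly_convex (direct_integral mu mE (ltr1_lee1 p1)).
Proof.
move=> sc; apply/strictly_convexP => x y.
rewrite -(dclass_repr x) -(dclass_repr y) => x1 y1 /(ae_norm_mid x1 y1) xy.
apply/dclassP; apply: filterS2 sc xy => s sc [xy mid].
exact: strictly_convex_mid sc _ _ xy mid.
Qed.

End direct_integral.

(** * Fibers of the family and sets of finite positive measure *)

Lemma ae_ex (R : realType) (d : measure_display) (S : measurableType d)
    (mu : {measure set S -> \bar R}) (A : set S) (P : S -> Prop) :
  measurable A -> mu A != 0%E -> {ae mu, forall s, P s} ->
  exists2 s, A s & P s.
Proof.
move=> mA muA aeP; apply: contrapT => nP; move/eqP : muA; apply.
apply/negligibleP => //; apply: negligibleS aeP => s As Ps.
by apply: nP; exists s.
Qed.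

Section fibers.
Context (R : realType) (d : measure_display) (S : measurableType d).
Variables (mu : {measure set S -> \bar R}) (E : S -> completeNormedModType R).
Variables mE : measurable_family E.

Lemma measurable_space_of (B : set (spaces E)) :
  measurable (space_of E @^-1` B).
Proof. by rewrite -[X in measurable X]setTI; exact: mE. Qed.

Lemma measurable_fiber (t : S) : measurable (fiber E (E t)).
Proof.
have -> : fiber E (E t) = space_of E @^-1` [set space_of E t].
  by apply/seteqP; split=> s /space_ofP.
exact: measurable_space_of.
Qed.

(** The condition depends on [s] only through the space [E s], and every set of spaces is measurable
    for the discrete sigma-algebra. *)
Lemma measurable_null_fibers : measurable [set s | mu (fiber E (E s)) = 0%E].
Proof.
have -> : [set s | mu (fiber E (E s)) = 0%E] =
    space_of E @^-1` [set phi | mu (fiber E (Defs.space phi)) = 0%E].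
  by apply/seteqP; split=> s /=; rewrite -spaceE.
exact: measurable_space_of.
Qed.

(** Some trace of [B] on an exhausting set of finite measure is not null, since otherwise [B] would
    be a countable union of null sets. *)
Lemma sigma_finite_subset (B : set S) : sigma_finite [set: S] mu ->
  measurable B -> mu B != 0%E ->
  exists A, [/\ A `<=` B, measurable A, mu A != 0%E & (mu A < +oo)%E].
Proof.
move=> [F FT Ffin] mB muB; apply: contrapT => noA.
move/eqP : muB; apply; apply/negligibleP => //.
rewrite -[B]setIT FT setI_bigcupr; apply: negligible_bigcup => i.
have [mF muF] := Ffin i.
have mBF : measurable (B `&` F i) by exact: measurableI.
apply/negligibleP => //; apply: contrapT => /eqP muBF; apply: noA.
exists (B `&` F i); split=> //; apply: le_lt_trans muF.
by apply: le_measure; rewrite ?inE.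
Qed.

End fibers.

(** * Sections constant on a subset of one fiber *)

Section cst_section.
Context (R : realType) (d : measure_display) (S : measurableType d).
Variables (E : S -> completeNormedModType R) (t : S) (A : set S).
Hypothesis AF : A `<=` fiber E (E t).

(** For [s] in [A], the spaces [E t] and [E s] are equal only propositionally. The test uses
    [pselect] because its proof of [A s] supplies the equality along which [x] is transported. *)
Definition cst_section (x : E t) : section E := fun s =>
  if pselect (A s) is left As then cast_space (esym (AF As)) x else 0.

Lemma cst_section_in x s (As : A s) :
  cst_section x s = cast_space (esym (AF As)) x.
Proof.
rewrite /cst_section; case: pselect => // As'.
by rewrite (Prop_irrelevance As As').
Qed.

Lemma cst_section_out x s : ~ A s -> cst_section x s = 0.
Proof. by rewrite /cst_section; case: pselect. Qed.

Lemma norm_cst_section x s : `|cst_section x s| = `|x| * \1_A s.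
Proof.
have [As|nAs] := pselect (A s).
  by rewrite cst_section_in norm_cast_space indicE mem_set// mulr1.
by rewrite cst_section_out// normr0 indicE memNset// mulr0.
Qed.

Lemma cst_sectionD x y s :
  cst_section (x + y) s = cst_section x s + cst_section y s.
Proof.
have [As|nAs] := pselect (A s); first by rewrite !cst_section_in cast_spaceD.
by rewrite !cst_section_out// addr0.
Qed.

Lemma cst_sectionZ a x s : cst_section (a *: x) s = a *: cst_section x s.
Proof.
have [As|nAs] := pselect (A s); first by rewrite !cst_section_in cast_spaceZ.
by rewrite !cst_section_out// scaler0.
Qed.

Lemma cst_section_inj x y s : A s -> cst_section x s = cst_section y s -> x = y.
Proof.
move=> As xy; apply/eqP; rewrite -subr_eq0 -(cast_space_eq0 (esym (AF As))).
rewrite -cst_section_in cst_sectionD -scaleN1r cst_sectionZ scaleN1r xy.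
by rewrite subrr.
Qed.

(** Once [phi] and [psi] are identified, the casts differ only in their equality proofs, which are
    equal by proof irrelevance. This makes [cst_section] genuinely constant on [A] as a map to the
    coproduct. *)
Lemma inj_space_cast (F : completeNormedModType R) (phi psi : spaces E)
    (e : F = Defs.space phi) (e' : F = Defs.space psi) (x : F) :
  phi = psi -> inj_space (cast_space e x) = inj_space (cast_space e' x).
Proof. by move=> pp; case: _ / pp in e' *; rewrite (Prop_irrelevance e e'). Qed.

Lemma to_coproduct_cst_section x s : A s ->
  to_coproduct (cst_section x) s = inj_space (cast_space (spaceE E t) x).
Proof.
move=> As; rewrite /to_coproduct cst_section_in.
have castK (F G H : completeNormedModType R) (e : F = G) (e' : G = H) y :
    cast_space e' (cast_space e y) = cast_space (etrans e e') y.
  by case: _ / e'; case: _ / e.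
by rewrite castK; apply: inj_space_cast; apply/space_ofP; exact: AF.
Qed.

Lemma strongly_measurable_cst_section x : measurable_family E -> measurable A ->
  strongly_measurable (cst_section x).
Proof.
move=> mE mA; set a := inj_space (cast_space (spaceE E t) x).
split; last first.
  apply/separable_setP; exists [set a]; first exact: countable1.
  move=> _ [s /= bs <-]; apply: subset_closure.
  have [As|nAs] := pselect (A s); first by rewrite to_coproduct_cst_section.
  by rewrite cst_section_out// eqxx in bs.
apply/measurable_sectionP => U oU.
(* Zeros of distinct spaces are distinct points of the coproduct, so off [A] the section may vary;
   there measurability comes from the zero section. *)
have m0 : measurable (to_coproduct (0 : section E) @^-1` U).
  by have [/measurable_sectionP + _] := strongly_measurable0 mE; exact.
have -> : to_coproduct (cst_section x) @^-1` U =
    (A `&` [set _ | U a]) `|` (~` A `&` to_coproduct (0 : section E) @^-1` U).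
  apply/seteqP; split=> s /=.
    have [As|nAs] := pselect (A s).
      by rewrite to_coproduct_cst_section//; left.
    by rewrite /to_coproduct cst_section_out//; right.
  move=> [[As]|[nAs]]; first by rewrite to_coproduct_cst_section.
  by rewrite /to_coproduct cst_section_out.
apply: measurableU; apply: measurableI => //; last exact: measurableC.
have [Ua|nUa] := pselect (U a).
  by rewrite (_ : [set _ | _] = setT)//; apply/seteqP; split.
by rewrite (_ : [set _ | _] = set0)//; apply/seteqP; split.
Qed.

(** The [p]-th power of the norm integrates to the finite product of the [p]-th power of [|x|] and
    [mu A]. *)
Lemma cst_section_norm_lty (mu : {measure set S -> \bar R}) (p : R) x :
  0 < p -> measurable A -> (mu A < +oo)%E ->
  (section_norm mu p%:E (cst_section x) < +oo)%E.
Proof.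
move=> p0 mA muA; apply: (@lty_poweRy _ _ p); first by rewrite gt_eqF.
rewrite (poweR_Lnorm _ _ (lt0r_neq0 p0)).
have norm_powR s : `|cst_section x s| `^ p = `|x| `^ p * \1_A s.
  rewrite norm_cst_section indicE; case: (s \in A); first by rewrite !mulr1.
  by rewrite !mulr0 powR0// gt_eqF.
under eq_integral => s _ do rewrite poweR_EFin normr_id norm_powR EFinM.
rewrite ge0_integralZl_EFin ?powR_ge0//; last first.
  exact/measurable_EFinP/measurable_indic.
by rewrite integral_indic// setIT lte_mul_pinfty// lee_fin powR_ge0.
Qed.

End cst_section.

(** * From the direct integral to the fibers *)

Section necessity.
Context (R : realType) (d : measure_display) (S : measurableType d).
Variables (mu : {measure set S -> \bar R}) (E : S -> completeNormedModType R).
Variables (mE : measurable_family E) (p : R) (p1 : 1 < p).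

Lemma strictly_convex_fiber (t : S) (A : set S) :
  A `<=` fiber E (E t) -> measurable A -> mu A != 0%E -> (mu A < +oo)%E ->
  strictly_convex (direct_integral mu mE (ltr1_lee1 p1)) ->
  strictly_convex (E t).
Proof.
move=> AF mA muA0 muA sc; apply/strictly_convexP => u v u1 v1 uv1.
have bL x : cst_section AF x \in Lp_pred mu mE (ltr1_lee1 p1).
  apply/asboolP; split; first exact: strongly_measurable_cst_section.
  exact: cst_section_norm_lty (lt_trans ltr01 p1) _ _.
pose f x : Lp_section mu mE (ltr1_lee1 p1) := exist _ (cst_section AF x) (bL x).
(* Equal norms in [E t] give equal pointwise norms of the sections. With the homogeneous
   [strictly_convex_mid], the scalar factor of the embedding can stay implicit. *)
have norm_f x y : `|x| = `|y| -> `|dclass (f x)| = `|dclass (f y)|.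
  move=> xy; rewrite !norm_dclass; congr fine; apply: eq_Lnorm => s.
  by rewrite /= !norm_cst_section xy.
have f_mid : 2^-1 *: (f u + f v) = f (2^-1 *: (u + v)).
  apply: val_inj; apply: functional_extensionality_dep => s.
  by rewrite /= cst_sectionZ cst_sectionD.
have /dclassP fuv : dclass (f u) = dclass (f v).
  apply: strictly_convex_mid sc _ _ _ _; first by apply: norm_f; rewrite u1.
  by rewrite -dclassD -dclassZ f_mid; apply: norm_f; rewrite uv1.
(* The two sections agree almost everywhere and [A] is not null, so they agree at some point of [A],
   where transport is injective. *)
have [s As] := ae_ex mA muA0 fuv; exact: cst_section_inj.
Qed.

End necessity.

Theorem theorem1 (R : realType) (d : measure_display) (S : measurableType d)
    (mu : {measure set S -> \bar R}) (E : S -> completeNormedModType R) (p : R)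
    (mu_sigma_finite : sigma_finite [set: S] mu)
    (mE : measurable_family E) (dE : discrete_family E mu) (p1 : 1 < p) :
  strictly_convex (direct_integral mu mE (ltr1_lee1 p1)) <->
  {ae mu, forall s, strictly_convex (E s)}.
Proof.
split; last exact: strictly_convex_direct_integral.
(* The exceptional set consists of the points with a null fiber; discreteness makes it null. *)
move=> sc; exists [set s | mu (fiber E (E s)) = 0%E].
split; [exact: measurable_null_fibers|exact: dE|].
move=> s /=; apply: contra_notP => /eqP mus.
have [A [AF mA muA0 muA]] :=
  sigma_finite_subset mu_sigma_finite (measurable_fiber mE s) mus.
exact: strictly_convex_fiber AF mA muA0 muA sc.
Qed.
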